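(* Let $q$ be a prime power, let $n$ be an even positive integer, and let $U$ be an $\mathbb{F}_q$-subspace of $\mathbb{F}_{q^n}$. For any element $\beta\in\mathbb{F}_{q^n}$ of degree $2$ over $\mathbb{F}_q$ with $\beta\notin\mathrm{Stab}(U)$, the code $\mathrm{Orb}_\beta(U)$ is a sunflower.
   Context: For an $\mathbb{F}_q$-subspace $U$ of $\mathbb{F}_{q^n}$ and $\alpha\in\mathbb{F}_{q^n}^*$, $\alpha U=\{\alpha u\mid u\in U\}$ and $\mathrm{Stab}(U)=\{\alpha\in\mathbb{F}_{q^n}^*\mid \alpha U=U\}$. For $\beta\in\mathbb{F}_{q^n}^*\setminus\{1\}$ of multiplicative order $|\beta|$, $\mathrm{Orb}_\beta(U)=\{\beta^iU\mid i=0,1,\ldots,|\beta|-1\}$. $\mathrm{Orb}_\beta(U)$ is called a sunflower if there is an $\mathbb{F}_q$-subspace $T$ of $\mathbb{F}_{q^n}$ (its center) such that $xU\cap zU=T$ for all $xU,zU\in\mathrm{Orb}_\beta(U)$ with $xU\neq zU$. The degree of $\beta$ is the degree of its minimal polynomial over $\mathbb{F}_q$. *)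

(* Defs.v *)
From mathcomp Require Import all_boot all_fingroup all_algebra all_field.

Set Implicit Arguments.
Unset Strict Implicit.
Unset Printing Implicit Defensive.

Import GRing.Theory.
Local Open Scope ring_scope.

(* F_q is a finFieldType F; F_{q^n} is an L : fieldExtType F of dimension n;
   F_q-subspaces of F_{q^n} are elements of {vspace L}. *)

Definition scalev (F : finFieldType) (L : fieldExtType F) (a : L)
    (U : {vspace L}) : {vspace L} :=
  (amull a @: U)%VS.

Definition Stab (F : finFieldType) (L : fieldExtType F) (U : {vspace L}) :
    {pred L} :=
  [pred a : L | (a != 0) && (scalev a U == U)].

(* The order of x in the group of units of L, with junk value 0 at x = 0.
   The alias finvect_type L is L with its finite field structure. *)
Definition mult_order (F : finFieldType) (L : fieldExtType F) (x : L) : nat :=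
  if insub (x : finvect_type L) is Some u then #[u : {unit finvect_type L}]%g
  else 0%N.

Definition Orb (F : finFieldType) (L : fieldExtType F) (b : L)
    (U : {vspace L}) : seq {vspace L} :=
  [seq scalev (b ^+ i) U | i <- iota 0 (mult_order b)].

Definition sunflower (F : finFieldType) (L : fieldExtType F)
    (C : seq {vspace L}) : Prop :=
  exists T : {vspace L},
    forall V W : {vspace L}, V \in C -> W \in C -> V != W -> (V :&: W)%VS = T.

(* 1%VS is the copy of F inside L. *)
Definition degree (F : finFieldType) (L : fieldExtType F) (b : L) : nat :=
  (size (minPoly 1%VS b)).-1.

(* Main.v *)
(** Let K = F(b) and W = {v in U | b v in U}.  Since b has degree 2, W is
    stable under K.  For nonzero x, z in K with xU <> zU, write x / z = s + t b
    with s, t in F; then t <> 0.  If w lies in xU and zU, then v = w / x and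
    (s + t b) v both lie in U, so b v lies in U, v lies in W and w = x v lies
    in W.  Conversely w in W gives w / x and w / z in W, a subspace of U.
    Hence W is the common intersection. *)
Require Import Defs.
From mathcomp Require Import all_boot all_fingroup all_algebra all_field.

Set Implicit Arguments.
Unset Strict Implicit.
Unset Printing Implicit Defensive.

Import GRing.Theory.
Local Open Scope ring_scope.

Lemma mem_scalev (F : finFieldType) (L : fieldExtType F) (a : L)
    (U : {vspace L}) (w : L) :
  a != 0 -> (w \in scalev a U) = (a^-1 * w \in U).
Proof.
move=> a0; apply/memv_imgP/idP => [[u uU ->]|wU].
  by rewrite lfunE /= mulKf.
by exists (a^-1 * w) => //; rewrite lfunE /= mulVKf.
Qed.

(** The polynomial [Fadjoin_poly] representing [c] at [b] has size at most 2; [s] and [t] are its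
    two coefficients. *)
Lemma degree2_decomp (F : finFieldType) (L : fieldExtType F) (b c : L) :
  degree b = 2%N -> c \in <<1; b>>%VS ->
  exists s t : F, c = s%:A + t *: b.
Proof.
rewrite /degree size_minPoly /= => deg2 /Fadjoin_poly_eq <-.
set p := Fadjoin_poly _ _ _.
have sz : (size p <= 2)%N by rewrite -deg2 size_Fadjoin_poly.
have /polyOverP pF : p \is a polyOver 1%VS by apply: Fadjoin_polyOver.
have /vlineP[s ps] := pF 0%N; have /vlineP[t pt] := pF 1%N.
exists s, t; rewrite (horner_coef_wide _ sz) !big_ord_recl big_ord0 /=.
by rewrite ps pt expr0 expr1 mulr1 addr0 mulr_algl.
Qed.

(** By linearity it suffices to multiply by [b]; as [b ^+ 2] is again in F + F b, [b * (b * v)] is a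
    combination of [v] and [b * v], both in [U]. *)
Lemma degree2_core_stable (F : finFieldType) (L : fieldExtType F) (b c v : L)
    (U : {vspace L}) :
  degree b = 2%N -> c \in <<1; b>>%VS ->
  v \in (U :&: amull b @^-1: U)%VS -> c * v \in (U :&: amull b @^-1: U)%VS.
Proof.
move=> deg2 /(degree2_decomp deg2) [s [t ->]].
have bK : b ^+ 2 \in <<1; b>>%VS by rewrite rpredX // memv_adjoin.
have [s' [t' b2]] := degree2_decomp deg2 bK.
rewrite mulrDl mulr_algl -scalerAl => vW.
apply: memvD; apply: memvZ => //; move: vW.
rewrite !memv_cap -!memv_preim !lfunE /= => /andP[vU bvU].
by rewrite bvU mulrA -expr2 b2 mulrDl mulr_algl -scalerAl memvD ?memvZ.
Qed.

Lemma cap_scalev_degree2 (F : finFieldType) (L : fieldExtType F) (b x z : L)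
    (U : {vspace L}) :
  degree b = 2%N -> x \in <<1; b>>%VS -> z \in <<1; b>>%VS ->
  x != 0 -> z != 0 -> scalev x U != scalev z U ->
  (scalev x U :&: scalev z U)%VS = (U :&: amull b @^-1: U)%VS.
Proof.
move=> deg2 xK zK x0 z0 neq.
have [s [t xz]] : exists s t : F, x / z = s%:A + t *: b.
  by apply: degree2_decomp; rewrite // rpred_div.
have zE w : z^-1 * w = s *: (x^-1 * w) + t *: (b * (x^-1 * w)).
  rewrite -mulr_algl [t *: _]scalerAl -mulrDl -xz.
  by rewrite [x / z]mulrC -mulrA mulVKf.
have t0 : t != 0.
  (* If [t = 0], then [x / z] is a nonzero scalar of F, which forces xU = zU. *)
  apply: contraNneq neq => t0; apply/eqP/vspaceP => w.
  have s0 : s != 0.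
    apply: contraTneq (mulf_neq0 x0 (invr_neq0 z0)) => s0.
    by rewrite xz s0 t0 !scale0r addr0 eqxx.
  rewrite !mem_scalev // zE t0 scale0r addr0.
  by rewrite (rpredZeq U) (negPf s0).
apply/vspaceP => w; rewrite memv_cap !mem_scalev //.
apply/andP/idP => [[xwU]|wW].
  (* Drop the summand already in [U], then cancel the nonzero scalar [t]. *)
  rewrite zE (rpredDl _ (memvZ s xwU)) (rpredZeq U) (negPf t0) => bU.
  rewrite -(mulVKf x0 w); apply: degree2_core_stable => //.
  by rewrite memv_cap -memv_preim lfunE xwU.
have stab c : c \in <<1; b>>%VS -> c * w \in U.
  by move=> /(degree2_core_stable deg2)/(_ wW); rewrite memv_cap => /andP[].
by split; apply: stab; rewrite rpredV.
Qed.

Local Close Scope ring_scope.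

Theorem theorem9 (q n : nat)
    (hq : exists p k : nat, [/\ prime p, (0 < k)%N & q = (p ^ k)%N])
    (hn : (0 < n)%N) (hn_even : ~~ odd n)
    (F : finFieldType) (hF : #|F| = q)
    (L : fieldExtType F) (hL : \dim {:L} = n)
    (U : {vspace L}) (b : L)
    (hdeg : degree b = 2) (hb : b \notin Stab U) :
  sunflower (Orb b U).
Proof.
have b0 : b != 0%R.
  (* Zero lies in F, hence has degree 1. *)
  apply: contra_eqN hdeg => /eqP->.
  have adj0 : adjoin_degree 1%VS (0 : L)%R = 1.
    by apply/eqP; rewrite (adjoin_deg_eq1 1%AS) mem0v.
  by rewrite /degree size_minPoly adj0.
(* All multipliers in the orbit lie in F(b), so the center is the same for every pair. *)
have bK i : (b ^+ i)%R \in <<1; b>>%VS by rewrite rpredX // memv_adjoin.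
exists (U :&: amull b @^-1: U)%VS => V W /mapP[i _ ->] /mapP[j _ ->].
by apply: cap_scalev_degree2; rewrite ?expf_neq0.
Qed.
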